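(* Let $T$ be a frequently hypercyclic operator on a Banach space $X$. If $T$ admits a frequently hypercyclic subspace, then there exists a product $\times$ on $X$ such that $(X,\times)$ is a commutative Banach algebra and the set $FHC(T)$ of frequently hypercyclic vectors for $T$ is strongly algebrable with respect to $\times$.
   Context: A vector $x$ is frequently hypercyclic for $T$ if for every non-empty open $U\subset X$ the set $\{n\in\mathbb N_0:T^nx\in U\}$ has positive lower density $\liminf_{N\to\infty}\frac{\mathrm{card}(A\cap[0,N])}{N+1}$. A frequently hypercyclic subspace for $T$ is a closed infinite-dimensional subspace all of whose non-zero elements are frequently hypercyclic for $T$. A Banach algebra is an associative complex algebra that is a Banach space with $\|xy\|\le\|x\|\|y\|$. For a commutative algebra, $FHC(T)$ is strongly algebrable if there is an algebraically independent sequence $(x_n)_n$ such that every non-zero element of the algebra generated by $(x_n)_n$ lies in $FHC(T)$ (equivalently, $FHC(T)$ contains, except zero, an infinitely generated algebra isomorphic to a free algebra). *)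

(* Defs.v *)
From HB Require Import structures.
From mathcomp Require Import all_boot all_order all_algebra.
(* mpoly must be imported BEFORE mathcomp-analysis (notation level clash) *)
From mathcomp Require Import mpoly.
From mathcomp Require Import all_classical all_reals all_analysis.
From mathcomp Require Import complex.
Set Implicit Arguments. Unset Strict Implicit. Unset Printing Implicit Defensive.
Import Order.TTheory GRing.Theory Num.Theory.
Import numFieldNormedType.Exports.
Local Open Scope classical_set_scope.
Local Open Scope ring_scope.

Section FHC.
Variables (R : realType) (X : normedModType R[i]).

Definition pos_lower_density (A : set nat) : Prop :=
  (0 < limn_einf (fun N : nat =>
     ((count (fun k => k \in A) (iota 0 N.+1))%:R / (N.+1)%:R : R)%:E))%E.

Definition freq_hypercyclic (T : X -> X) (x : X) : Prop :=
  forall U : set X, open U -> U !=set0 ->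
    pos_lower_density [set n | U (iter n T x)].

Definition lin_indep n (v : 'I_n -> X) : Prop :=
  forall c : 'I_n -> R[i], \sum_(i < n) c i *: v i = 0 -> forall i, c i = 0.

Definition infinite_dimensional (M : set X) : Prop :=
  forall n, exists v : 'I_n -> X, (forall i, M (v i)) /\ lin_indep v.

Definition is_subspace (M : set X) : Prop :=
  M 0 /\ (forall x y, M x -> M y -> M (x + y)) /\
  (forall (a : R[i]) x, M x -> M (a *: x)).

Definition FHC_subspace (T : X -> X) (M : set X) : Prop :=
  is_subspace M /\ closed M /\ infinite_dimensional M /\
  (forall x, M x -> x != 0 -> freq_hypercyclic T x).

(* (X, mul) is a commutative Banach algebra (X is complete by assumption) *)
Definition comm_banach_algebra_product (mul : X -> X -> X) : Prop :=
  (forall x y z, mul x (mul y z) = mul (mul x y) z) /\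
  (forall x y, mul x y = mul y x) /\
  (forall (a : R[i]) x y z, mul (a *: x + y) z = a *: mul x z + mul y z) /\
  (forall x y, `|mul x y| <= `|x| * `|y|).

(* product of a nonempty list in a possibly non-unital algebra; 0 on [::] *)
Definition nprod (mul : X -> X -> X) (s : seq X) : X :=
  if s is a :: s' then foldl mul a s' else 0.

Definition mono_eval (mul : X -> X -> X) (x : nat -> X) n
  (m : mpoly.multinom n) : X :=
  nprod mul (flatten [seq nseq (mpoly.fun_of_multinom m i) (x i) | i <- enum 'I_n]).

Definition poly_eval (mul : X -> X -> X) (x : nat -> X) n
  (p : mpoly.mpoly n R[i]) : X :=
  \sum_(m <- mpoly.msupp p) mpoly.mcoeff m p *: mono_eval mul x m.

Definition alg_independent (mul : X -> X -> X) (x : nat -> X) : Prop :=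
  forall n (p : mpoly.mpoly n R[i]),
    mpoly.mcoeff (@mpoly.mnm0 n) p = 0 -> p != 0 -> poly_eval mul x p != 0.

Definition FHC_strongly_algebrable (T : X -> X) (mul : X -> X -> X) : Prop :=
  exists x : nat -> X, alg_independent mul x /\
    forall n (p : mpoly.mpoly n R[i]),
      mpoly.mcoeff (@mpoly.mnm0 n) p = 0 -> poly_eval mul x p != 0 ->
      freq_hypercyclic T (poly_eval mul x p).

End FHC.

(* Main.v *)
(* The product is a weighted Dirichlet convolution.  A closed infinite-dimensional
   subspace [M] of frequently hypercyclic vectors contains vectors [e_n] which admit
   biorthogonal bounded functionals [phi_n] (Hahn-Banach), and each [e_n] can be
   chosen so small, compared with the norms of the earlier functionals, that
     x * y = sum_n (sum_(ij = n, i, j >= 2) phi_i(x) phi_j(y)) e_n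
   converges with norm at most |x| |y|.  Biorthogonality makes the coefficients of
   the product of x and y the Dirichlet convolution of those of x and y, whence
   associativity, and e_a * e_b = e_(ab) for a, b >= 2.  If q_0, q_1, ... are distinct
   primes, unique factorization sends distinct nonconstant monomials in the e_(q_k) to
   distinct e_n, so nonzero polynomials without constant term evaluate to nonzero
   elements of [M]. *)
Require Import Defs.
From HB Require Import structures.
From mathcomp Require Import all_boot all_order all_algebra.
From mathcomp Require Import mpoly.
From mathcomp Require Import all_classical all_reals all_analysis.
From mathcomp Require Import complex ring lra zify.
Import Order.TTheory GRing.Theory Num.Theory.
Import numFieldNormedType.Exports.
Local Open Scope classical_set_scope.
Local Open Scope ring_scope.

(** * Real Hahn-Banach theorem through minimal sublinear functionals *)

Section HahnBanach.
Context {R : realType} {V : lmodType R}.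
Implicit Types (p q : V -> R).

(** Homogeneity is asked as an inequality, the form that is checked for infima; applying it to
    [t^-1] gives equality. *)
Definition sublinear p : Prop :=
  (forall x y, p (x + y) <= p x + p y) /\
  (forall (t : R) x, 0 < t -> p (t *: x) <= t * p x).

Lemma sublinearZ p (t : R) x : sublinear p -> 0 < t -> p (t *: x) = t * p x.
Proof.
move=> [_ pZ] t0; apply/eqP; rewrite eq_le pZ //=.
rewrite -ler_pdivlMl //.
have := pZ t^-1 (t *: x); rewrite invr_gt0 => /(_ t0).
by rewrite scalerA mulVf ?gt_eqF // scale1r.
Qed.

Lemma sublinear0 p : sublinear p -> p 0 = 0.
Proof.
move=> sp; have := sublinearZ p 2 0 sp (ltr0Sn _ _).
rewrite scaler0; lra.
Qed.

Lemma sublinearN_ge p x : sublinear p -> - p (- x) <= p x.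
Proof. by move=> sp; have := sp.1 x (- x); rewrite subrr sublinear0 //; lra. Qed.

(** The infimum of [p (x + t *: y) - t * p y] over [t >= 0] is such a [q]: [t = 0] gives [q <= p],
    and [t = 1] at [- y] gives the last bound. *)
Lemma sublinear_lower p y : sublinear p ->
  exists q, [/\ sublinear q, forall x, q x <= p x & q (- y) <= - p y].
Proof.
move=> sp.
pose A x := [set p (x + t *: y) - t * p y | t in [set t | 0 <= t]].
have Ane x : A x !=set0 by exists (p (x + 0 *: y) - 0 * p y), 0 => /=.
have tp t : 0 <= t -> t * p y = p (t *: y).
  rewrite le_eqVlt => /predU1P[<-|t0]; last by rewrite sublinearZ.
  by rewrite mul0r scale0r sublinear0.
have Alb x : has_lbound (A x).
  exists (- p (- x)) => _ [t /= t0 <-].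
  have := sp.1 (x + t *: y) (- x); rewrite addrAC subrr add0r -tp //; lra.
have qle x t : 0 <= t -> inf (A x) <= p (x + t *: y) - t * p y.
  by move=> t0; apply: ge_inf => //; exists t.
exists (fun x => inf (A x)); split.
- split=> [x x'|s x s0].
    rewrite -lerBlDr; apply: lb_le_inf => // _ [t /= t0 <-].
    rewrite lerBlDl -lerBlDr; apply: lb_le_inf => // _ [u /= u0 <-].
    have := qle (x + x') (t + u) (addr_ge0 t0 u0).
    have := sp.1 (x + t *: y) (x' + u *: y).
    rewrite addrACA -scalerDl mulrDl; lra.
  rewrite -ler_pdivrMl //; apply: lb_le_inf => // _ [t /= t0 <-].
  rewrite ler_pdivrMl //.
  have := qle (s *: x) (s * t) (mulr_ge0 (ltW s0) t0).
  by rewrite -scalerA -scalerDr sublinearZ // -mulrA -mulrBr.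
- by move=> x; have := qle x 0 (lexx _); rewrite scale0r addr0 mul0r subr0.
- by have := qle (- y) 1 ler01; rewrite scale1r addNr sublinear0 // mul1r add0r.
Qed.

(** Zorn's lemma for the reversed pointwise order. The pointwise infimum bounds a chain; it is
    finite because each sublinear [q] below [p] satisfies [- p (- x) <= q x]. *)
Lemma sublinear_minimal p : sublinear p ->
  exists q, [/\ sublinear q, forall x, q x <= p x &
    forall r, sublinear r -> (forall x, r x <= q x) -> r = q].
Proof.
move=> sp.
pose T := {q | sublinear q /\ forall x, q x <= p x}.
pose ge (a b : T) := `[< forall x, sval b x <= sval a x >].
have [||||[q [sq qp]] qmin] := @Zorn T ge.
- by move=> a; apply/asboolP.
- move=> a b c /asboolP ab /asboolP bc; apply/asboolP => x.
  exact: le_trans (bc x) (ab x).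
- move=> [a ha] [b hb] /asboolP ab /asboolP ba; apply: eq_exist => /=.
  by apply/funext => x; apply/eqP; rewrite eq_le ab ba.
- move=> C Ctot; have [->|/set0P[c0 Cc0]] := eqVneq C set0.
    by exists (exist _ p (conj sp (fun x => lexx _))).
  pose A x := [set sval c x | c in C].
  have Ane x : A x !=set0 by exists (sval c0 x), c0.
  have Alb x : has_lbound (A x).
    exists (- p (- x)) => _ [[q [sq qp]] /= _ <-].
    by apply: le_trans (sublinearN_ge _ x sq); rewrite lerN2.
  have infle c x : C c -> inf (A x) <= sval c x.
    by move=> Cc; apply: ge_inf => //; exists c.
  have infp x : inf (A x) <= p x.
    exact: le_trans (infle c0 x Cc0) ((svalP c0).2 x).
  have sinf : sublinear (fun x => inf (A x)).
    split=> [x y|t x t0].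
      rewrite -lerBlDr; apply: lb_le_inf => // _ [c Cc <-].
      rewrite lerBlDl -lerBlDr; apply: lb_le_inf => // _ [d Cd <-].
      (* Members of a chain are comparable, so the smaller one serves at both points. *)
      have [e [Ce ec ed]] : exists e, [/\ C e, sval e x <= sval c x &
          sval e y <= sval d y].
        by case: (Ctot c d Cc Cd) => /asboolP h; [exists d|exists c].
      have := infle e (x + y) Ce; have := (svalP e).1.1 x y; lra.
    rewrite -ler_pdivrMl //; apply: lb_le_inf => // _ [c Cc <-].
    rewrite ler_pdivrMl //; apply: le_trans (infle c _ Cc) _.
    exact: (svalP c).1.2.
  exists (exist _ (fun x => inf (A x)) (conj sinf infp)) => c Cc; apply/asboolP => x /=.
  exact: infle.
- exists q; split=> // r sr rq.
  have rp x : r x <= p x := le_trans (rq x) (qp x).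
  have := qmin (exist _ r (conj sr rp)).
  by move=> /(_ (asboolT rq)) [].
Qed.

(* The pointwise order has minimal sublinear functionals, and such a minimal
   functional is odd, hence linear: otherwise [sublinear_lower] would decrease it. *)
Lemma hahn_banach_sublinear p (x0 : V) : sublinear p ->
  exists u : {linear V -> R^o}, (forall x, u x <= p x) /\ p x0 <= u x0.
Proof.
(* Minimizing below [q0] instead of [p] yields the bound at [x0]: [q (- x0) <= q0 (- x0) <= - p x0],
   and [q] is odd. *)
move=> /(sublinear_lower _ x0)[q0 [sq0 q0p q0x]].
have [q [sq qq0 qmin]] := sublinear_minimal _ sq0.
have qN y : q (- y) = - q y.
  apply/eqP; rewrite eq_le; have [r [sr rq ry]] := sublinear_lower _ y sq.
  rewrite -{1}(qmin r sr rq) ry /=.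
  by have := sublinearN_ge _ y sq; rewrite lerNl.
have qD x y : q (x + y) = q x + q y.
  apply/eqP; rewrite eq_le sq.1 /=.
  by have := sq.1 (x + y) (- y); rewrite addrK qN; lra.
have qZ a x : q (a *: x) = a * q x.
  case: (ltgtP a 0) => [a0|a0|->].
  - rewrite -[a]opprK scaleNr qN sublinearZ ?oppr_gt0 //; ring.
  - exact: sublinearZ.
  - by rewrite scale0r mul0r sublinear0.
have ql : linear (q : V -> R^o) by move=> a x y; rewrite qD qZ.
pose L := GRing.isLinear.Build R V R^o *:%R (q : V -> R^o) ql.
pose u : {linear V -> R^o} := HB.pack (q : V -> R^o) L.
exists u; split=> [x|]; first exact: le_trans (qq0 x) (q0p x).
by have := qq0 (- x0); rewrite qN /u /=; lra.
Qed.
End HahnBanach.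

(** * Complex separating functionals from real ones *)

Section Complex.
Context {R : realType}.
Local Open Scope complex_scope.

(** A fresh name for [V], so that the real module structure does not compete with the complex
    one. *)
Definition restrict_scalars (V : lmodType R[i]) : Type := V.

Section RestrictScalars.
Context (V : lmodType R[i]).
HB.instance Definition _ := GRing.Zmodule.on (restrict_scalars V).

Definition real_scale (a : R) (x : restrict_scalars V) : restrict_scalars V :=
  (a%:C *: (x : V)).

Fact real_scaleA a b x : real_scale a (real_scale b x) = real_scale (a * b) x.
Proof. by rewrite /real_scale scalerA -rmorphM. Qed.

Fact real_scale1 : left_id 1 real_scale.
Proof. by move=> x; rewrite /real_scale scale1r. Qed.

Fact real_scaleDr : right_distributive real_scale +%R.
Proof. by move=> a x y; rewrite /real_scale scalerDr. Qed.

Fact real_scaleDl x : {morph real_scale^~ x : a b / a + b}.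
Proof. by move=> a b; rewrite /real_scale rmorphD scalerDl. Qed.

HB.instance Definition _ := GRing.Zmodule_isLmodule.Build R (restrict_scalars V)
  real_scaleA real_scale1 real_scaleDr real_scaleDl.
End RestrictScalars.

Lemma normedE (X : normedModType R[i]) (x : X) : `|x| = (complex.Re `|x|)%:C.
Proof. by rewrite RRe_real // ger0_real. Qed.

(* [u x - i u (i x)] is the complex functional with real part [u]. *)
Lemma separating_functional (X : normedModType R[i]) (x0 : X) : x0 != 0 ->
  exists phi : {linear X -> R[i]^o},
    (forall x, `|phi x| <= 2 * `|x|) /\ phi x0 != 0.
Proof.
move=> x0_neq0.
pose p (x : restrict_scalars X) := complex.Re `|x : X|.
have sp : sublinear p.
  split=> [x y|t x t0].
    by rewrite /p -lecR rmorphD /= -!normedE ler_normD.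
  by rewrite /p -lecR rmorphM /= -!normedE normrZ ger0_norm // ler0c ltW.
have [u [up ux0]] := hahn_banach_sublinear p (x0 : restrict_scalars X) sp.
pose f (x : X) : R[i]^o := u x +i* - u ('i%C *: x : X).
have uD (x y : X) : u (x + y) = u x + u y by apply: (raddfD u).
have uZ (a : R) (x : X) : u (a%:C *: x) = a * u x.
  exact: (linearZ_LR u a (x : restrict_scalars X)).
have uN (x : X) : u (- x) = - u x by apply: (raddfN u).
have fl : linear f.
  move=> [a b] x y.
  have eZ (z : X) : (a +i* b) *: z = a%:C *: z + b%:C *: ('i%C *: z).
    rewrite scalerA -scalerDl; congr (_ *: _); by simpc.
  have iZ : 'i%C *: ((a +i* b) *: x) = a%:C *: ('i%C *: x) + b%:C *: (- x).
    rewrite -scaleN1r !scalerA -scalerDl; congr (_ *: _); by simpc.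
  rewrite /f scalerDr iZ eZ !uD !uZ uN.
  apply/eqP; rewrite eq_complex /=; apply/andP; split; apply/eqP; ring.
pose L := GRing.isLinear.Build R[i] X R[i]^o *:%R f fl.
pose phi : {linear X -> R[i]^o} := HB.pack f L.
exists phi; split=> [x|]; last first.
  rewrite /phi /= /f eq_complex negb_and /=; apply/orP; left.
  rewrite gt_eqF //; apply: lt_le_trans ux0; rewrite /p -ltcR -normedE.
  by rewrite normr_gt0.
have ub (y : X) : `|u y| <= complex.Re `|y|.
  by rewrite ler_norml up andbT lerNl -uN; apply: le_trans (up _) _; rewrite /p normrN.
have nC (a : R) : `|a%:C| = `|a|%:C by rewrite normc_def /= expr0n addr0 sqrtr_sqr.
have ni : `|'i%C : R[i]| = 1.
  by rewrite normc_def /= expr0n expr1n add0r sqrtr1.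
have -> : phi x = (u x)%:C - 'i%C * (u ('i%C *: x : X))%:C.
  by rewrite /phi /= /f; simpc.
(* Bounding the two parts separately costs the factor 2; the biorthogonal construction only needs
   some finite constant. *)
apply: le_trans (ler_normB _ _) _; rewrite normrM ni mul1r !nC mulr_natl mulr2n.
apply: lerD; rewrite normedE lecR ?ub //.
have := ub ('i%C *: x); rewrite normrZ ni mul1r; exact.
Qed.
End Complex.

(** * Recursive choice and biorthogonal sequences *)

Lemma dependent_choice_seq (A : Type) (a0 : A) (Q : seq A -> A -> Prop) :
  (forall (s : nat -> A) n, (forall k, (k < n)%N -> Q (mkseq s k) (s k)) ->
    exists a, Q (mkseq s n) a) ->
  exists s : nat -> A, forall n, Q (mkseq s n) (s n).
Proof.
move=> Qex.
pose f l :=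
  if pselect (exists a, Q l a) is left Ql then sval (cid Ql) else a0.
pose L := fix L n := if n is m.+1 then rcons (L m) (f (L m)) else [::].
have LE n : L n = mkseq (f \o L) n.
  by elim: n => //= n IH; rewrite mkseqS -IH.
exists (f \o L) => n; elim/ltn_ind: n => n IH.
have := Qex _ _ IH; rewrite -LE /= /f; case: pselect => // Ql _.
exact: (svalP (cid Ql)).
Qed.

Section Biorthogonal.
Context {R : realType} {X : normedModType R[i]}.
Local Notation K := (R[i]).

Lemma functionalZ (f : {linear X -> K^o}) a x : f (a *: x) = a * f x.
Proof. exact: linearZ_LR. Qed.

Lemma functionalP (f : {linear X -> K^o}) a x y : f (a *: x + y) = a * f x + f y.
Proof. exact: linearP. Qed.

(** Dimension count: the values of [n] functionals on [n.+1] independent vectors form a matrix with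
    a nonzero left kernel vector, whose entries are the coefficients of [e]. *)
Lemma common_zero (M : set X) n (phi : 'I_n -> {linear X -> K^o}) :
  is_subspace M -> infinite_dimensional M ->
  exists2 e, M e & e != 0 /\ forall k, phi k e = 0.
Proof.
move=> [M0 [MD MZ]] /(_ n.+1)[v [Mv vfree]].
pose A : 'M[K]_(n.+1, n) := \matrix_(i, k) phi k (v i).
have /rowV0Pn[c /sub_kermxP cA c0] : kermx A != 0.
  by rewrite kermx_eq0 -row_leq_rank -ltnNge ltnS rank_leq_col.
exists (\sum_i c 0 i *: v i).
  by elim/big_ind: _ => // i _; exact: MZ.
split=> [|k].
  apply: contra_neq c0 => /vfree c0; apply/rowP => i; rewrite c0 mxE //.
have := congr1 (fun w : 'rV_n => w 0 k) cA; rewrite !mxE => cAk.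
rewrite raddf_sum -[RHS]cAk.
by apply: eq_bigr => i _; rewrite /= functionalZ mxE.
Qed.

Lemma biorthogonal_step (M : set X) n (e : nat -> X)
    (phi : nat -> {linear X -> K^o}) (C : nat -> K) (delta : K) :
  is_subspace M -> infinite_dimensional M -> 0 < delta ->
  (forall k x, (k < n)%N -> `|phi k x| <= C k * `|x|) ->
  (forall i j, (i < n)%N -> (j < n)%N -> phi i (e j) = (i == j)%:R) ->
  exists e' (phi' : {linear X -> K^o}) C',
    [/\ M e', forall x, `|phi' x| <= C' * `|x|, phi' e' = 1,
     `|e'| <= delta & forall k, (k < n)%N -> phi k e' = 0 /\ phi' (e k) = 0].
Proof.
move=> Msub Minf delta0 phiC phie.
have [e0 Me0 [e00 phi0]] := common_zero M n (fun k => phi k) Msub Minf.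
have [psi [psiC psi0]] := separating_functional X e0 e00.
pose t := delta / `|e0|.
have t0 : 0 < t by rewrite divr_gt0 // normr_gt0.
have tpsi : t * psi e0 != 0 by rewrite mulf_neq0 // gt_eqF.
(* The correction makes [psi] vanish on the earlier [e j] and keeps its value at [e0], where all
   earlier [phi j] vanish; the division normalizes the value at [t *: e0] to 1. *)
pose f (x : X) : K^o :=
  (psi x - \sum_(j < n) psi (e j) * phi j x) / (t * psi e0).
have fl : linear f.
  move=> a x y; rewrite -[RHS]/(a * f x + f y) /f functionalP.
  under eq_bigr do rewrite functionalP mulrDr mulrCA.
  by rewrite big_split /= -mulr_sumr mulrA -mulrDl mulrBr opprD addrACA.
pose L := GRing.isLinear.Build K X K^o *:%R f fl.
pose phi' : {linear X -> K^o} := HB.pack f L.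
exists (t *: e0), phi', ((2 + \sum_(j < n) `|psi (e j)| * C j) / `|t * psi e0|).
split.
- exact: Msub.2.2.
- move=> x; rewrite /phi' /= /f normrM normfV [leRHS]mulrAC ler_wpM2r ?invr_ge0 //.
  rewrite mulrDl; apply: (le_trans (ler_normB _ _)); apply: lerD; first exact: psiC.
  apply: (le_trans (ler_norm_sum _ _ _)); rewrite mulr_suml ler_sum // => j _.
  by rewrite normrM -mulrA ler_wpM2l ?phiC.
- rewrite /phi' /= /f big1 ?subr0 ?functionalZ ?divff //.
  by move=> j _; rewrite functionalZ phi0 !mulr0.
- by rewrite normrZ gtr0_norm // divfK // normr_eq0.
move=> k kn; rewrite functionalZ /= (phi0 (Ordinal kn)) mulr0; split=> //.
rewrite /phi' /= /f (bigD1 (Ordinal kn)) //= phie // eqxx mulr1 big1 ?addr0 ?subrr ?mul0r //.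
by move=> j jk; rewrite phie // (negPf jk : (j == k :> nat) = false) mulr0.
Qed.

(** Only the constants [C i] with [i < n] enter the bound on [e n], and they are known when [e n] is
    chosen. *)
Lemma biorthogonal_sequence (M : set X) : is_subspace M -> infinite_dimensional M ->
  exists (e : nat -> X) (phi : nat -> {linear X -> K^o}) (C : nat -> K),
    [/\ forall n, M (e n), forall n x, `|phi n x| <= C n * `|x|,
     forall i j, phi i (e j) = (i == j)%:R &
     forall n, `|e n| * (\sum_(i < n) C i) ^+ 2 <= 2^-1 ^+ n].
Proof.
move=> Msub Minf.
pose a0 : X * {linear X -> K^o} * K := (0, (\0 : {linear X -> K^o}), 0).
pose Q (l : seq (X * {linear X -> K^o} * K)) (a : X * {linear X -> K^o} * K) :=
  [/\ M a.1.1, forall x, `|a.1.2 x| <= a.2 * `|x|, a.1.2 a.1.1 = 1,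
   `|a.1.1| * (\sum_(b <- l) b.2) ^+ 2 <= 2^-1 ^+ size l &
   forall k, (k < size l)%N ->
     (nth a0 l k).1.2 a.1.1 = 0 /\ a.1.2 (nth a0 l k).1.1 = 0].
have biorth (s : nat -> _) n : (forall k, (k < n)%N -> Q (mkseq s k) (s k)) ->
    forall i j, (i < n)%N -> (j < n)%N -> (s i).1.2 (s j).1.1 = (i == j)%:R.
  move=> Qs i j ilt jlt; case: ltngtP => [ij|ji|<-].
  - have [_ _ _ _] := Qs j jlt; rewrite size_mkseq => /(_ i ij)[].
    by rewrite nth_mkseq.
  - have [_ _ _ _] := Qs i ilt; rewrite size_mkseq => /(_ j ji)[_].
    by rewrite nth_mkseq.
  - by have [] := Qs i ilt.
have [s n IH|s Qs] := dependent_choice_seq _ a0 Q.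
  pose S := \sum_(b <- mkseq s n) b.2.
  have C0 k : (k < n)%N -> 0 <= (s k).2.
    move=> /IH[_ sC _ _ _]; have [x x0] : exists x : X, x != 0.
      have [v [_ vfree]] := Minf 1%N; exists (v ord0); apply/eqP => v0.
      have := vfree (fun=> 1); rewrite big_ord1 scale1r v0 => /(_ erefl ord0).
      by move/eqP; rewrite oner_eq0.
    rewrite -(@pmulr_lge0 _ `|x|) ?normr_gt0 //; exact: le_trans (sC x).
  have S0 : 0 <= S.
    by rewrite /S /mkseq big_map big_seq sumr_ge0 // => k; rewrite mem_iota => /C0.
  (* The summand 1 keeps the denominator positive when [S] is 0. *)
  have d0 : 0 < 2^-1 ^+ n / (1 + S ^+ 2) :> K.
    by rewrite divr_gt0 ?exprn_gt0 ?invr_gt0 // ltr_pwDl // exprn_ge0.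
  have [||e' [phi' [C' [Me' phiC' phie' e'd phi0]]]] := biorthogonal_step M n
    (fun k => (s k).1.1) (fun k => (s k).1.2) (fun k => (s k).2) _ Msub Minf d0.
  - by move=> k x /IH[].
  - exact: biorth.
  exists (e', phi', C'); split => //=.
    rewrite size_mkseq; apply: le_trans (_ : _ <= 2^-1 ^+ n / (1 + S ^+ 2) * (1 + S ^+ 2)) _.
      by apply: ler_pM; rewrite ?exprn_ge0 ?lerDr.
    by rewrite divfK // gt_eqF // ltr_pwDl // exprn_ge0.
  by rewrite size_mkseq => k kn; rewrite nth_mkseq //; exact: phi0.
exists (fun n => (s n).1.1), (fun n => (s n).1.2), (fun n => (s n).2); split.
- by move=> n; have [] := Qs n.
- by move=> n; have [] := Qs n.
- by move=> i j; apply: (biorth s (maxn i j).+1) => //; rewrite ltnS ?leq_maxl ?leq_maxr.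
- move=> n; have [_ _ _] := Qs n; rewrite size_mkseq /mkseq big_map.
  by rewrite -[X in iota 0 X]subn0 big_mkord.
Qed.
End Biorthogonal.

(** * Convergence of sequences with geometrically small steps *)

Section Series.
Context {R : realType}.
Local Notation K := (R[i]).

(** Nonnegative elements of [R[i]] are real, so the Archimedean property of [R] and [n < 2 ^ n]
    apply. *)
Lemma geometric_small (B eps : K) : 0 <= B -> 0 < eps ->
  exists n, B * 2^-1 ^+ n < eps.
Proof.
move=> B0 eps0.
have BE := RRe_real (ger0_real B0); have epsE := RRe_real (gtr0_real eps0).
move: B0 eps0; rewrite -BE -epsE; move: (complex.Re B) (complex.Re eps) => b e.
rewrite ler0c (ltcR 0) => b0 e0; exists (Num.bound (b / e)).
set n := Num.bound _.
have bn : b / e < n%:R by apply: archi_boundP; rewrite divr_ge0 // ltW.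
have n2 : (n%:R : R) <= 2 ^+ n by rewrite -natrX ler_nat ltnW // ltn_expl.
rewrite exprVn ltr_pdivrMr ?exprn_gt0 //.
have -> : (2 : K) ^+ n = (2 ^+ n : R)%:C%C by rewrite rmorphXn rmorph_nat.
rewrite -rmorphM ltcR mulrC -ltr_pdivrMr //; exact: lt_le_trans bn n2.
Qed.

Lemma cvg_geometric_steps (X : completeNormedModType K) (S : nat -> X) (B : K) :
  0 <= B -> (forall n, `|S n.+1 - S n| <= B * 2^-1 ^+ n) ->
  exists2 l, S @ \oo --> l & forall n, `|l - S n| <= B * 2 * 2^-1 ^+ n.
Proof.
move=> B0 dS.
(* The exact partial geometric sum makes the induction on [k] close. *)
have tele n k : `|S (k + n)%N - S n| <= B * 2 * 2^-1 ^+ n * (1 - 2^-1 ^+ k).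
  elim: k => [|k IH]; first by rewrite subrr normr0 expr0 subrr mulr0.
  have -> : S (k.+1 + n)%N - S n = (S (k + n).+1 - S (k + n)%N) + (S (k + n)%N - S n).
    by rewrite addrA subrK.
  apply: le_trans (ler_normD _ _) _; apply: le_trans (lerD (dS _) IH) _.
  rewrite le_eqVlt; apply/orP; left; apply/eqP.
  by rewrite exprD exprS; field.
have tail n m : (n <= m)%N -> `|S m - S n| <= B * 2 * 2^-1 ^+ n.
  move=> nm; rewrite -(subnK nm); apply: le_trans (tele n _) _.
  by rewrite ler_piMr ?mulr_ge0 ?exprn_ge0 ?invr_ge0 // lerBlDr lerDl.
have /cauchy_cvgP /cvg_ex[l Sl] : cauchy (S @ \oo).
  apply: cauchy_exP => eps eps0.
  have [n nB] := geometric_small (B * 2) eps (mulr_ge0 B0 (ler0n _ _)) eps0.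
  exists (S n); exists n => // m /= nm; rewrite -ball_normE /= distrC.
  exact: le_lt_trans (tail n m nm) nB.
exists l => // n; apply/ler_addgt0Pr => eps eps0.
have [m [nm lm]] : exists m, (n <= m)%N /\ `|l - S m| < eps.
  have /cvgrPdist_lt/(_ _ eps0)[N _ lS] := Sl.
  by exists (maxn n N); split; [exact: leq_maxl | exact/lS/leq_maxr].
rewrite -(subrK (S m) l) -addrA addrC; apply: le_trans (ler_normD _ _) _.
by apply: lerD; [exact: tail|exact: ltW].
Qed.
End Series.

(** * Dirichlet convolution over factors at least 2 *)

Section Dirichlet.
Context {K : comRingType}.
Implicit Types f g h : nat -> K.

(* Excluding the indices 0 and 1 makes the value at [n] depend only on the values
   of [f] and [g] below [n]. *)
Definition dconv f g n : K :=
  \sum_(i < n) \sum_(j < n | [&& 1 < i, 1 < j & i * j == n]%N) f i * g j.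

Lemma dconvC f g n : dconv f g n = dconv g f n.
Proof.
rewrite /dconv (exchange_big_dep predT) //=; apply: eq_bigr => i _.
by apply: eq_big => [j|j _]; rewrite 1?mulrC // mulnC andbCA.
Qed.

Lemma eq_dconv f f' g g' : f =1 f' -> g =1 g' -> dconv f g =1 dconv f' g'.
Proof. by move=> ff gg n; apply: eq_bigr => i _; apply: eq_bigr => j _; rewrite ff gg. Qed.

Lemma dconv_linear a f f' g n :
  dconv (fun i => a * f i + f' i) g n = a * dconv f g n + dconv f' g n.
Proof.
rewrite /dconv mulr_sumr -big_split; apply: eq_bigr => i _ /=.
rewrite mulr_sumr -big_split; apply: eq_bigr => j _ /=.
by rewrite mulrDl mulrA.
Qed.

Lemma dconv_widen f g k n : (k <= n)%N -> dconv f g k =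
  \sum_(i < n) \sum_(j < n | [&& 1 < i, 1 < j & i * j == k]%N) f i * g j.
Proof.
move=> kn; rewrite /dconv (big_ord_widen n (fun i =>
  \sum_(j < k | [&& 1 < i, 1 < j & i * j == k]%N) f i * g j)) // big_mkcond.
apply: eq_bigr => i _; rewrite (big_ord_widen_cond n
  (fun j => [&& 1 < i, 1 < j & i * j == k]%N) (fun j => f i * g j)) //.
case: ltnP => ik.
  apply: eq_bigl => j; apply/andP/idP => [[]//|ij]; split=> //; nia.
by rewrite big_pred0 // => j; apply/negP => ij; nia.
Qed.

(** A triple sum whose condition is symmetric in the three indices; associativity then only permutes
    the sums. *)
Lemma dconv_dconv f g h n : dconv (dconv f g) h n =
  \sum_(l < n) \sum_(i < n) \sum_(j < n)
    if [&& 1 < i, 1 < j, 1 < l & i * j * l == n]%N then f i * g j * h l else 0.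
Proof.
rewrite -[LHS]/(\sum_(k < n)
  \sum_(l < n | [&& 1 < k, 1 < l & k * l == n]%N) dconv f g k * h l).
under eq_bigr => k _ do rewrite big_mkcond.
rewrite exchange_big; apply: eq_bigr => l _ /=.
(* All ranges are widened to [n] and [k] is tied to [i * j], so that the sum over [k] collapses once
   it is innermost. *)
transitivity (\sum_(k < n) \sum_(i < n) \sum_(j < n)
    if ([&& 1 < i, 1 < j, 1 < l & i * j * l == n]%N && (k == i * j :> nat)%N)
    then f i * g j * h l else 0).
  apply: eq_bigr => k _; rewrite (dconv_widen _ _ _ _ (ltnW (ltn_ord k))).
  case: ifPn => [kl|nkl].
    rewrite mulr_suml; apply: eq_bigr => i _.
    rewrite mulr_suml big_mkcond; apply: eq_bigr => j _.
    congr (if _ then _ else _); apply/idP/idP => ij; nia.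
  rewrite big1 // => i _; rewrite big1 // => j _; case: ifPn => // ij.
  by exfalso; move: nkl ij; nia.
rewrite exchange_big; apply: eq_bigr => i _ /=.
rewrite exchange_big; apply: eq_bigr => j _ /=.
rewrite -big_mkcond; case: ifPn => [c|nc]; last by rewrite big_pred0.
have ijn : (i * j < n)%N by nia.
by rewrite (big_pred1 (Ordinal ijn)).
Qed.

Lemma dconvA f g h n : dconv f (dconv g h) n = dconv (dconv f g) h n.
Proof.
rewrite dconvC !dconv_dconv [RHS]exchange_big; apply: eq_bigr => i _ /=.
rewrite [RHS]exchange_big; apply: eq_bigr => j _; apply: eq_bigr => l _ /=.
rewrite mulrC mulrA; congr (if _ then _ else _); apply/idP/idP => ?; nia.
Qed.

Lemma dconv_delta a b n : (1 < a)%N -> (1 < b)%N ->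
  dconv (fun i => (a == i)%:R) (fun i => (b == i)%:R) n = (a * b == n)%:R.
Proof.
move=> a1 b1; rewrite /dconv; have [abn|abn] := eqVneq (a * b)%N n; last first.
  rewrite big1 // => i _; rewrite big1 // => j /and3P[_ _ /eqP ij].
  case: eqVneq => [ai|]; last by rewrite mul0r.
  case: eqVneq => [bj|]; last by rewrite mulr0.
  by move: abn; rewrite ai bj ij eqxx.
have an : (a < n)%N by nia.
have bn : (b < n)%N by nia.
rewrite (bigD1 (Ordinal an)) //= (bigD1 (Ordinal bn)) /=; last first.
  by rewrite a1 b1 abn eqxx.
rewrite !eqxx mulr1 !big1 ?addr0 //.
  by move=> i; rewrite -val_eqE /= eq_sym => /negPf ai; rewrite big1 // => j _; rewrite ai mul0r.
by move=> j /andP[_]; rewrite -val_eqE /= eq_sym => /negPf ->; rewrite mulr0.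
Qed.

End Dirichlet.

(** * The Banach algebra product *)

Section Product.
Context {R : realType} {X : completeNormedModType R[i]}.
Local Notation K := (R[i]).

(** A product is the limit of partial sums determined by the coefficients [c x y]. Since
    [phi n (mul x y) = c x y n], the algebraic laws reduce to those of [dconv]. *)
Lemma dirichlet_product (e : nat -> X) (phi : nat -> {linear X -> K^o}) (C : nat -> K) :
  (forall n x, `|phi n x| <= C n * `|x|) ->
  (forall i j, phi i (e j) = (i == j)%:R) ->
  (forall n, `|e n| * (\sum_(i < n) C i) ^+ 2 <= 2^-1 ^+ n) ->
  exists2 mul : X -> X -> X, comm_banach_algebra_product mul &
    forall a b, (1 < a)%N -> (1 < b)%N -> mul (e a) (e b) = e (a * b)%N.
Proof.
move=> phiC phie eC.
pose c (x y : X) : nat -> K := dconv (fun i => phi i x : K) (fun i => phi i y : K).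
have cC x y n : `|c x y n| <= (\sum_(i < n) C i) ^+ 2 * (`|x| * `|y|).
  rewrite expr2 mulrACA !mulr_suml; apply: le_trans (ler_norm_sum _ _ _) _.
  apply: ler_sum => i _; rewrite mulr_sumr; apply: le_trans (ler_norm_sum _ _ _) _.
  rewrite big_mkcond; apply: ler_sum => j _.
  have ij : `|(phi i x : K) * phi j y| <= C i * `|x| * (C j * `|y|).
    by rewrite normrM ler_pM.
  by case: ifP => _ //; apply: le_trans ij.
pose S x y n := \sum_(k < n) c x y k *: e k.
have mul_ex x y : exists l, S x y @ \oo --> l /\ `|l| <= `|x| * `|y|.
  have B0 : 0 <= `|x| * `|y| by rewrite mulr_ge0.
  have [|l Sl lS] := cvg_geometric_steps X (S x y) _ B0.
    move=> n; rewrite /S big_ord_recr /= addrAC subrr add0r normrZ.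
    apply: le_trans (ler_wpM2r _ (cC x y n)) _ => //.
    by rewrite mulrAC mulrC ler_wpM2l // mulrC.
  (* At index 1 the tail bound is exactly [|x| |y|], and the partial sum is 0 because [c x y 0] is
     an empty sum. *)
  exists l; split=> //; have := lS 1%N.
  rewrite /S big_ord1 {1}/c /dconv big_ord0 scale0r subr0 expr1.
  by rewrite mulfK.
pose mul x y := sval (cid (mul_ex x y)).
have mulS x y : S x y @ \oo --> mul x y := (svalP (cid (mul_ex x y))).1.
have mul_le x y : `|mul x y| <= `|x| * `|y| := (svalP (cid (mul_ex x y))).2.
have mul_unique x y l : S x y @ \oo --> l -> mul x y = l.
  exact: cvg_unique (mulS x y).
have phiS x y n m : (n < m)%N -> phi n (S x y m) = c x y n.
  move=> nm; rewrite /S raddf_sum (bigD1 (Ordinal nm)) //= big1.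
    by rewrite functionalZ phie eqxx mulr1 addr0.
  move=> k; rewrite -val_eqE /= eq_sym functionalZ phie => /negPf ->.
  by rewrite mulr0.
have C0 n : 0 <= C n.
  have en0 : e n != 0.
    by apply: contra_eq_neq (phie n n) => ->; rewrite raddf0 eqxx eq_sym oner_eq0.
  rewrite -(@pmulr_lge0 _ `|e n|) ?normr_gt0 //; exact: le_trans (phiC n (e n)).
have phi_mul x y n : phi n (mul x y) = c x y n.
  (* Continuity of [phi n]: its value on the partial sums is [c x y n] from index [n.+1] on. Using
     [C n + 1] avoids dividing by 0. *)
  apply/eqP; rewrite -subr_eq0 -normr_le0; apply/ler_addgt0Pr => eps eps0.
  rewrite add0r; pose C1 := C n + 1.
  have C10 : 0 < C1 by rewrite ltr_wpDl ?C0.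
  have /cvgrPdist_lt/(_ _ (divr_gt0 eps0 C10))[N _ mN] := mulS x y.
  have := mN (maxn N n.+1) (leq_maxl _ _); rewrite ltr_pdivlMr // => /ltW.
  apply: le_trans; rewrite -(phiS x y n _ (leq_maxr N n.+1)) -raddfB mulrC.
  apply: le_trans (phiC _ _) _; by rewrite ler_wpM2r // lerDl.
exists mul; [split; [|split; [|split]]|].
- move=> x y z; apply: mul_unique.
  rewrite (_ : S x (mul y z) = S (mul x y) z) //; apply/funext => n.
  apply: eq_bigr => k _; congr (_ *: _).
  transitivity (dconv (fun i => phi i x : K) (c y z) k).
    by apply: eq_dconv => // i; exact: phi_mul.
  by rewrite dconvA; apply: eq_dconv => // i; rewrite phi_mul.
- move=> x y; apply: mul_unique; rewrite (_ : S x y = S y x) //.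
  by apply/funext => n; apply: eq_bigr => k _; rewrite /c dconvC.
- move=> a x y z; apply: mul_unique.
  rewrite (_ : S _ z = (fun n => a *: S x z n + S y z n)).
    by apply: cvgD; [apply: cvgZ; [exact: cvg_cst|]|]; exact: mulS.
  apply/funext => n; rewrite /S scaler_sumr -big_split; apply: eq_bigr => k _ /=.
  rewrite scalerA -scalerDl -dconv_linear; congr (_ *: _).
  by apply: eq_dconv => // i; rewrite functionalP.
- exact: mul_le.
(* The coefficients form the point mass at [a * b], so the partial sums are constant beyond that
   index. *)
move=> a b a1 b1; apply: mul_unique; apply: cvg_near_cst.
have cE k : c (e a) (e b) k = (a * b == k)%:R.
  by rewrite -dconv_delta //; apply: eq_dconv => i; rewrite phie eq_sym.
exists (a * b).+1 => // n /= abn; rewrite /S (bigD1 (Ordinal abn)) //= big1.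
  by rewrite cE eqxx scale1r addr0.
by move=> k; rewrite -val_eqE /= cE eq_sym => /negPf ->; rewrite scale0r.
Qed.
End Product.

(** * Encoding monomials by prime factorizations *)

Lemma prime_sequence : exists2 q : nat -> nat, injective q & forall k, prime (q k).
Proof.
pose q k := iter k (fun p => s2val (prime_above p)) 2%N.
have qlt : {homo q : i j / (i < j)%N}.
  by apply: homo_ltn => [|k]; [exact: ltn_trans | exact: s2valP (prime_above (q k))].
exists q => [i j qij|[|k] //]; last exact: (s2valP' (prime_above (q k))).
by case: (ltngtP i j) => // /qlt; rewrite qij ltnn.
Qed.

(** Valuations recover every exponent, which makes the encoding of monomials by integers
    injective. *)
Lemma logn_prod_prime_powers (q : nat -> nat) n (m : 'I_n -> nat) (j : 'I_n) :
  injective q -> (forall k, prime (q k)) ->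
  logn (q j) (\prod_(i < n) q i ^ m i) = m j.
Proof.
move=> q_inj qp; have qm0 (i : 'I_n) : (0 < q i ^ m i)%N.
  by rewrite expn_gt0 prime_gt0.
rewrite (bigD1 j) //= lognM ?prodn_cond_gt0 // pfactorK //.
rewrite (_ : logn _ _ = 0%N) ?addn0 //.
elim/big_ind: _ => [|a b a0 b0|i ij]; first exact: logn1.
  have [->|a_gt0] := posnP a; first by rewrite mul0n logn0.
  have [->|b_gt0] := posnP b; first by rewrite muln0 logn0.
  by rewrite lognM // a0 b0.
by rewrite lognX logn_prime // (inj_eq q_inj) (inj_eq val_inj) eq_sym (negPf ij) muln0.
Qed.

Section Monomials.
Context {R : realType} {X : normedModType R[i]} (mul : X -> X -> X) (e : nat -> X)
  (mulE : forall a b, (1 < a)%N -> (1 < b)%N -> mul (e a) (e b) = e (a * b)%N).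

(** Induction with the head generalized, since [foldl] accumulates there and the accumulated index
    stays above 1. The empty list is excluded because [nprod] has the default value 0 on it. *)
Lemma nprod_map s : s != [::] -> all (fun a => 1 < a)%N s ->
  nprod mul (map e s) = e (\prod_(a <- s) a)%N.
Proof.
case: s => //= b s _ /andP[b1 s1]; rewrite big_cons.
elim: s b b1 s1 => [|a s IH] b b1 /=; first by rewrite big_nil muln1.
by move=> /andP[a1 s1]; rewrite mulE // IH ?big_cons ?mulnA //; nia.
Qed.

Lemma mono_eval_prime_powers (q : nat -> nat) n (m : mpoly.multinom n) :
  (forall k, prime (q k)) -> m != mpoly.mnm0 ->
  mono_eval mul (e \o q) m = e (\prod_(i < n) q i ^ mpoly.fun_of_multinom m i)%N.
Proof.
move=> qp m0; rewrite /mono_eval.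
pose s := flatten [seq nseq (mpoly.fun_of_multinom m i) (q i) | i <- enum 'I_n].
have -> : flatten [seq nseq (mpoly.fun_of_multinom m i) ((e \o q) i) | i <- enum 'I_n]
    = map e s.
  by rewrite map_flatten -map_comp; congr flatten; apply: eq_map => i /=; rewrite map_nseq.
have sE : (\prod_(a <- s) a = \prod_(i < n) q i ^ mpoly.fun_of_multinom m i)%N.
  rewrite big_flatten big_map enumT; apply: eq_bigr => i _.
  by rewrite big_nseq iter_muln_1.
rewrite nprod_map ?sE //.
  (* A positive exponent would put its prime into [s], so an empty [s] forces the trivial
     monomial. *)
  apply: contra_neq m0 => s0; apply/mpoly.mnmP => i; rewrite mpoly.mnm0E.
  apply/eqP; rewrite -leqn0 leqNgt; apply/negP => mi.
  suff : q i \in s by rewrite s0.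
  by apply/flatten_mapP; exists i; rewrite ?mem_enum // mem_nseq mi /=.
apply/allP => a /flatten_mapP[i _ /nseqP[-> _]]; exact: prime_gt1.
Qed.
End Monomials.

(** * Strong algebrability of the frequently hypercyclic vectors *)

Theorem theorem4p3 (R : realType) (X : completeNormedModType R[i])
  (T : {linear X -> X}) (hTc : continuous T)
  (hT : exists x : X, freq_hypercyclic T x)
  (hsub : exists M : set X, FHC_subspace T M) :
  exists mul : X -> X -> X,
    comm_banach_algebra_product mul /\ FHC_strongly_algebrable T mul.
Proof.
have [M [Msub [_ [Minf MT]]]] := hsub.
have [e [phi [C [Me phiC phie eC]]]] := biorthogonal_sequence M Msub Minf.
have [mul mul_alg mulE] := dirichlet_product e phi C phiC phie eC.
have [q q_inj qp] := prime_sequence.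
exists mul; split=> //; exists (e \o q); pose N n (m : mpoly.multinom n) :=
  (\prod_(i < n) q i ^ mpoly.fun_of_multinom m i)%N.
have N_inj n : injective (N n).
  move=> m m' mm'; apply/mpoly.mnmP => i.
  by rewrite -(logn_prod_prime_powers q n _ i q_inj qp) -/(N n m) mm' logn_prod_prime_powers.
have evalE n (p : mpoly.mpoly n R[i]) : mpoly.mcoeff (@mpoly.mnm0 n) p = 0 ->
    poly_eval mul (e \o q) p =
    \sum_(m <- mpoly.msupp p) mpoly.mcoeff m p *: e (N n m).
  move=> p0; apply: eq_big_seq => m mp.
  rewrite (mono_eval_prime_powers _ _ mulE) //.
  (* The vanishing constant term keeps the trivial monomial out of the support. *)
  by apply: contraTneq mp => ->; rewrite mpoly.mcoeff_msupp p0 eqxx.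
split=> [n p p0 pn0|n p p0].
  rewrite evalE //; have [m mp] : exists m, m \in mpoly.msupp p.
    move: pn0; rewrite -mpoly.msupp_eq0; case: (mpoly.msupp p) => // m s _.
    by exists m; rewrite mem_head.
  (* By biorthogonality and injectivity of [N n], this functional extracts the nonzero coefficient
     of [m]. *)
  apply/eqP => /(congr1 (phi (N n m))); rewrite raddf0 raddf_sum => /eqP.
  rewrite (bigD1_seq m) ?mpoly.msupp_uniq //= functionalZ phie eqxx mulr1 big1.
    by rewrite addr0 mpoly.mcoeff_eq0 mp.
  move=> m' m'm; rewrite functionalZ phie (inj_eq (N_inj n)) eq_sym (negPf m'm).
  by rewrite mulr0.
rewrite evalE // => pn0; apply: MT => //.
elim/big_ind: _ => [|x y|m _]; [exact: Msub.1|exact: Msub.2.1|exact: Msub.2.2].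
Qed.
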